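(* Let $G=\langle X\mid R\rangle$ be a group with $X$ finite and $R$ not necessarily finite. Let $H$ be a finite index subgroup of $G$. For each vertex $v$ of $\Gamma_{X,R}(H)$ let $p_v$ be a reduced path in $\Gamma_{X,R}(H)$ from $1_H$ to $v$, with label $\mu(p_v)=g_v$ (regarded as an element of $G$). Then $g_v\in N_G(H)$ if and only if $(\Gamma_{X,R}(H),1_H)$ and $(\Gamma_{X,R}(H),v)$ are isomorphic as based $X$-graphs. Furthermore, let $V$ be the set of vertices $v$ of $\Gamma_{X,R}(H)$ such that $(\Gamma_{X,R}(H),1_H)$ is isomorphic to $(\Gamma_{X,R}(H),v)$ as based $X$-graphs. Then $$N_G(H)=\bigcup_{v\in V}Hg_v.$$
   Context: $N_G(H)=\{g\in G\mid gHg^{-1}=H\}$ is the normalizer of $H$ in $G$. An $X$-graph is a directed graph $\Gamma$ (loops and multiple edges allowed) in which every directed edge $e$, with origin $o(e)$ and terminus $t(e)$, carries a label $\mu(e)\in X$. A morphism of $X$-graphs maps vertices to vertices and directed edges to directed edges, preserving labels, origins and termini; a morphism of based $X$-graphs $(\Gamma,v)\to(\Gamma',v')$ also maps $v$ to $v'$. An isomorphism is an invertible morphism. $\widehat\Gamma$ is obtained from $\Gamma$ by adding, for each edge $e$, a formal inverse $e^{-1}$ with $o(e^{-1})=t(e)$, $t(e^{-1})=o(e)$, $\mu(e^{-1})=\mu(e)^{-1}$. A path $p$ in $\Gamma$ is a sequence $e_1,\dots,e_k$ of edges of $\widehat\Gamma$ with $o(e_i)=t(e_{i-1})$, from $o(e_1)$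 to $t(e_k)$, with label $\mu(p)=\mu(e_1)\cdots\mu(e_k)$; a single vertex is also a path, with empty label. A path is reduced if it has no subpath $e,e^{-1}$ with $e$ an edge of $\widehat\Gamma$. Labels are words in $X\cup X^{-1}$ and are regarded as elements of $G$ via the canonical epimorphism from the free group $F(X)$ to $G$. For a finite index subgroup $H$ of $G=\langle X\mid R\rangle$, the subgroup graph $\Gamma_{X,R}(H)$ is the Schreier coset graph of $H$ with respect to $X$ and $G$: its vertices are the right cosets $Hg$ ($g\in G$), and for each coset $Hg$ and each $x\in X$ there is one directed edge labeled $x$ with origin $Hg$ and terminus $Hgx$. Its base-vertex $1_H$ is the coset $H$. *)

(* Defs.v *)
From HB Require Import structures.
From mathcomp Require Import all_boot.
From mathcomp Require Import boolp classical_sets functions cardinality.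

Set Implicit Arguments.
Unset Strict Implicit.
Unset Printing Implicit Defensive.

Local Open Scope classical_set_scope.
Local Open Scope group_scope.

(** ** Words in the generators and group presentations *)

(* The letter (x, false) stands for x and (x, true) for x^-1. *)
Notation letter X := (X * bool)%type.
Notation word X := (seq (X * bool)).

Definition letter_inv (X : Type) (l : letter X) : letter X := (l.1, ~~ l.2).

Definition letter_val (X : Type) (G : groupType) (iota : X -> G)
    (l : letter X) : G :=
  if l.2 then (iota l.1)^-1 else iota l.1.

Definition word_val (X : Type) (G : groupType) (iota : X -> G)
    (w : word X) : G :=
  \prod_(l <- w) letter_val iota l.

(* The smallest congruence on words that identifies l l^-1 (l a letter) and
   every relator with the empty word.  Its classes are the elements of the
   quotient of the free group F(X) by the normal closure of R. *)
Inductive pres_eq (X : Type) (R : set (word X)) : word X -> word X -> Prop :=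
| pres_refl w : pres_eq R w w
| pres_sym w1 w2 : pres_eq R w1 w2 -> pres_eq R w2 w1
| pres_trans w1 w2 w3 :
    pres_eq R w1 w2 -> pres_eq R w2 w3 -> pres_eq R w1 w3
| pres_cancel u l v : pres_eq R (u ++ l :: letter_inv l :: v) (u ++ v)
| pres_relator u r v : R r -> pres_eq R (u ++ r ++ v) (u ++ v).

(* G = < X | R > by way of iota, which need not be injective. *)
Definition is_presentation (X : Type) (R : set (word X)) (G : groupType)
    (iota : X -> G) : Prop :=
  (forall g : G, exists w : word X, word_val iota w = g) /\
  (forall w1 w2 : word X,
     word_val iota w1 = word_val iota w2 <-> pres_eq R w1 w2).

(** ** Cosets and normalizers in a possibly infinite group *)

Definition rcoset (G : groupType) (A : set G) (g : G) : set G :=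
  [set a * g | a in A].

Definition rcosets (G : groupType) (H : set G) : set (set G) :=
  range (rcoset H).

Definition finite_index (G : groupType) (H : set G) : Prop :=
  finite_set (rcosets H).

Definition normalizer (G : groupType) (H : set G) : set G :=
  [set g | [set g * h * g^-1 | h in H] = H].

Lemma rcosets_self (G : groupType) (H : set G) : H \in rcosets H.
Proof.
rewrite inE; exists 1 => //; apply/seteqP; split=> [_ [h hH <-]|h hH].
  by rewrite mulg1.
by exists h; rewrite ?mulg1.
Qed.

Lemma rcosets_mulr (G : groupType) (H : set G) (A : rcosets H) (g : G) :
  rcoset (val A) g \in rcosets H.
Proof.
have /set_mem[a _ <-] := valP A.
rewrite inE; exists (a * g) => //; apply/seteqP; split=> [_ [h hH <-]|].
  by exists (h * a); [exists h | rewrite mulgA].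
by move=> _ [_ [h hH <-] <-]; exists h; rewrite ?mulgA.
Qed.

(** ** Labelled directed graphs *)

Record xgraph (X : Type) := XGraph {
  vertex : Type;
  edge : Type;
  origin : edge -> vertex;
  terminus : edge -> vertex;
  label : edge -> X }.

Record xmorphism (X : Type) (Gam Del : xgraph X) := XMorphism {
  vmap : vertex Gam -> vertex Del;
  emap : edge Gam -> edge Del;
  origin_emap : forall e, origin (emap e) = vmap (origin e);
  terminus_emap : forall e, terminus (emap e) = vmap (terminus e);
  label_emap : forall e, label (emap e) = label e }.

Definition isomorphism (X : Type) (Gam Del : xgraph X)
    (f : xmorphism Gam Del) : Prop :=
  exists g : xmorphism Del Gam,
    (cancel (vmap f) (vmap g) /\ cancel (vmap g) (vmap f)) /\
    (cancel (emap f) (emap g) /\ cancel (emap g) (emap f)).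

(* The inverse of f is then automatically based, from (Del, w) to (Gam, v). *)
Definition based_isomorphic (X : Type) (Gam : xgraph X) (v : vertex Gam)
    (Del : xgraph X) (w : vertex Del) : Prop :=
  exists f : xmorphism Gam Del, isomorphism f /\ vmap f v = w.

(* The graph with formal inverse edges: (e, false) is e, (e, true) is e^-1. *)
Definition hat (X : Type) (Gam : xgraph X) : xgraph (letter X) :=
  {| vertex := vertex Gam;
     edge := edge Gam * bool;
     origin := fun e => if e.2 then terminus e.1 else origin e.1;
     terminus := fun e => if e.2 then origin e.1 else terminus e.1;
     label := fun e => (label e.1, e.2) |}.

Definition edge_inv (X : Type) (Gam : xgraph X) (e : edge (hat Gam)) :
    edge (hat Gam) :=
  (e.1, ~~ e.2).

Fixpoint is_path (X : Type) (Gam : xgraph X) (v : vertex Gam)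
    (p : seq (edge (hat Gam))) (w : vertex Gam) : Prop :=
  if p is e :: p' then origin e = v /\ @is_path X Gam (terminus e) p' w
  else v = w.

Definition reduced (X : Type) (Gam : xgraph X)
    (p : seq (edge (hat Gam))) : Prop :=
  forall p1 e p2, p <> p1 ++ e :: edge_inv e :: p2.

Definition path_label (X : Type) (Gam : xgraph X)
    (p : seq (edge (hat Gam))) : word X :=
  [seq label e | e <- p].

(** ** Schreier coset graphs *)

(* The edge (A, x) goes from the coset A to the coset A x, and is labelled x. *)
Definition subgroup_graph (X : Type) (G : groupType) (iota : X -> G)
    (H : set G) : xgraph X :=
  {| vertex := rcosets H;
     edge := rcosets H * X;
     origin := fun e => e.1;
     terminus := fun e => SigSub (rcosets_mulr e.1 (iota e.2));
     label := fun e => e.2 |}.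

Definition base_vertex (X : Type) (G : groupType) (iota : X -> G)
    (H : set G) : vertex (subgroup_graph iota H) :=
  SigSub (rcosets_self H).

(* Main.v *)
Require Import Defs.
From mathcomp Require Import all_boot.
From mathcomp Require Import boolp classical_sets functions cardinality.

(** Reading a label w along a path is right multiplication by the value of w,
    so the path [p v] forces the vertex v to be the coset H (g v)
    ([is_path_rcoset]).  Everything then reduces to a statement about a single
    element g of G ([based_isomorphic_normalizer]): g normalizes H exactly when
    the Schreier graph has an automorphism carrying the vertex H to H g.

    If g normalizes H, then g H a = H g a, so left multiplication by g permutes
    the right cosets; it commutes with the right multiplications that define
    the edges, hence is an automorphism of the labelled graph, with inverse left
    multiplication by g^-1 ([ltranslation]).  Conversely, since X generates G, a
    morphism of the graph commutes with right multiplication by every element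
    of G ([vmap_rcoset]), so it can only enlarge stabilizers of vertices; an
    automorphism preserves them.  As the stabilizer of H is H and that of H g
    is g^-1 H g, an automorphism carrying H to H g yields g^-1 H g = H.

    The formula for the normalizer follows by applying the same equivalence to
    the vertex H n, for an arbitrary n in G: that vertex is also H (g v). *)

Set Implicit Arguments.
Unset Strict Implicit.
Unset Printing Implicit Defensive.

Local Open Scope classical_set_scope.
Local Open Scope group_scope.

Section Cosets.
Variable G : groupType.
Implicit Types (A K : set G) (H : groupClosed G) (a b g n x : G).

Lemma rcosetP A g x : rcoset A g x <-> A (x * g^-1).
Proof.
split=> [[a Aa <-]|Ax]; first by rewrite mulgK.
by exists (x * g^-1); rewrite ?mulgVK.
Qed.

Lemma rcoset1 A : rcoset A 1 = A.
Proof. by apply/seteqP; split=> x; rewrite rcosetP invg1 mulg1. Qed.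

Lemma rcosetM A a b : rcoset A (a * b) = rcoset (rcoset A a) b.
Proof. by apply/seteqP; split=> x; rewrite !rcosetP invgM mulgA. Qed.

Lemma rcoset_self H g : rcoset [set` H] g g.
Proof. by apply/rcosetP; rewrite mulgV; exact: gpred1. Qed.

Lemma rcoset_eqP H a b :
  rcoset [set` H] a = rcoset [set` H] b <-> a * b^-1 \in H.
Proof.
split=> [eqab|Hab].
  by have := rcoset_self H a; rewrite eqab rcosetP.
apply/seteqP; split=> x; rewrite !rcosetP /= => Hx.
  by rewrite -(mulgVK a x) -mulgA gpredM.
by rewrite -(mulgVK b x) -mulgA gpredM // -gpredV invgM invgK.
Qed.

Lemma normalizerP A g : normalizer A g <-> forall x, A (g * x * g^-1) <-> A x.
Proof.
split=> [nAg x|nAg].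
  split=> [|Ax]; last by rewrite -[in X in X _]nAg; exists x.
  by rewrite -[in X in X _ -> _]nAg => -[y Ay /mulIg/mulgI <-].
apply/seteqP; split=> [_ [x Ax <-]|x Ax]; first exact/nAg.
have gVxg : g * (g^-1 * x * g) * g^-1 = x by rewrite !mulgA mulgK mulgV mul1g.
by exists (g^-1 * x * g) => //; apply/nAg; rewrite gVxg.
Qed.

Lemma normalizerV A g : normalizer A g -> normalizer A g^-1.
Proof.
rewrite !normalizerP => nAg x; rewrite -[in X in X <-> _]nAg.
by rewrite invgK !mulgA mulgK mulgV mul1g.
Qed.

Definition lcoset A g : set G := [set g * a | a in A].

Lemma lcosetP A g x : lcoset A g x <-> A (g^-1 * x).
Proof.
split=> [[a Aa <-]|Ax]; first by rewrite mulKg.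
by exists (g^-1 * x); rewrite ?mulVKg.
Qed.

Lemma lcosetK A a b : a * b = 1 -> lcoset (lcoset A b) a = A.
Proof.
move=> ab1; apply/seteqP; split=> x; rewrite !lcosetP mulgA -invgM ab1;
  by rewrite invg1 mul1g.
Qed.

Lemma lcoset_rcoset A a b : lcoset (rcoset A b) a = rcoset (lcoset A a) b.
Proof. by apply/seteqP; split=> x; rewrite ?(lcosetP, rcosetP) mulgA. Qed.

Lemma lcoset_normalizer A g : normalizer A g -> lcoset A g = rcoset A g.
Proof.
move=> /normalizerP nAg; apply/seteqP; split=> x;
  by rewrite lcosetP rcosetP -(nAg (g^-1 * x)) mulVKg.
Qed.

Lemma lcoset_rcosets K n (nKn : normalizer K n) (A : rcosets K) :
  lcoset (val A) n \in rcosets K.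
Proof.
have /set_mem[a _ <-] := valP A.
by rewrite inE lcoset_rcoset lcoset_normalizer // -rcosetM; exists (n * a).
Qed.

End Cosets.

Section SchreierGraph.
Variables (X : Type) (G : groupType) (iota : X -> G).

Lemma word_val_cons (l : letter X) (w : word X) :
  word_val iota (l :: w) = letter_val iota l * word_val iota w.
Proof. exact: big_cons. Qed.

Lemma is_path_rcoset (K : set G) (p : seq (edge (hat (subgroup_graph iota K))))
    (v w : vertex (subgroup_graph iota K)) :
  is_path v p w -> val w = rcoset (val v) (word_val iota (path_label p)).
Proof.
elim: p v => [|[[A x] b] p IHp] v /=.
  by move=> ->; rewrite /word_val big_nil rcoset1.
case=> <- /IHp ->; rewrite word_val_cons rcosetM.
(* Along a formal inverse edge the origin is A x and the terminus is A. *)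
by case: b; rewrite /letter_val //= -(rcosetM (val A)) mulgV rcoset1.
Qed.

Section LeftTranslation.
Variables (K : set G) (n : G) (nKn : normalizer K n).

Definition ltranslation_vmap (A : vertex (subgroup_graph iota K)) :
    vertex (subgroup_graph iota K) :=
  SigSub (lcoset_rcosets nKn A).

Definition ltranslation_emap (e : edge (subgroup_graph iota K)) :
    edge (subgroup_graph iota K) :=
  (ltranslation_vmap e.1, e.2).

Lemma ltranslation_terminus e :
  terminus (ltranslation_emap e) = ltranslation_vmap (terminus e).
Proof. by apply: val_inj; rewrite /= lcoset_rcoset. Qed.

Definition ltranslation :
    xmorphism (subgroup_graph iota K) (subgroup_graph iota K) :=
  XMorphism (fun=> erefl) ltranslation_terminus (fun=> erefl).

End LeftTranslation.

Lemma ltranslation_vmapK (K : set G) (m n : G)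
    (nKm : normalizer K m) (nKn : normalizer K n) :
  m * n = 1 -> cancel (ltranslation_vmap nKn) (ltranslation_vmap nKm).
Proof. by move=> mn1 A; apply: val_inj; rewrite /= lcosetK. Qed.

Lemma ltranslation_isomorphism (K : set G) (n : G) (nKn : normalizer K n) :
  isomorphism (ltranslation nKn).
Proof.
have nK := ltranslation_vmapK (normalizerV nKn) nKn (mulVg n).
have nVK := ltranslation_vmapK nKn (normalizerV nKn) (mulgV n).
exists (ltranslation (normalizerV nKn)); do 2!split=> //.
  by case=> A x; rewrite /= /ltranslation_emap /= nK.
by case=> A x; rewrite /= /ltranslation_emap /= nVK.
Qed.

Hypothesis iota_gen : forall g : G, exists w : word X, word_val iota w = g.

(** An edge labelled x from A to A x is sent to an edge labelled x, so a
    morphism commutes with right multiplication by generators, and by their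
    inverses after solving for A; words in the generators reach all of G. *)
Lemma vmap_rcoset (K L : set G)
    (f : xmorphism (subgroup_graph iota K) (subgroup_graph iota L))
    (A B : vertex (subgroup_graph iota K)) (g : G) :
  val B = rcoset (val A) g -> val (vmap f B) = rcoset (val (vmap f A)) g.
Proof.
have f_gen (C D : vertex (subgroup_graph iota K)) x :
    val D = rcoset (val C) (iota x) ->
  val (vmap f D) = rcoset (val (vmap f C)) (iota x).
  pose e : edge (subgroup_graph iota K) := (C, x).
  move=> eqD; have -> : D = terminus e by exact: val_inj.
  rewrite -terminus_emap.
  by case: (emap f e) (origin_emap f e) (label_emap f e) => ? ? /= -> ->.
have f_letter (C D : vertex (subgroup_graph iota K)) l :
    val D = rcoset (val C) (letter_val iota l) ->
  val (vmap f D) = rcoset (val (vmap f C)) (letter_val iota l).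
  case: l => x []; rewrite /letter_val /=; last exact: f_gen.
  move=> eqD; have /f_gen -> : val C = rcoset (val D) (iota x).
    by rewrite /= eqD -rcosetM mulVg rcoset1.
  by rewrite -rcosetM mulgV rcoset1.
have [w <-] := iota_gen g; elim: w A => [|l w IHw] A.
  by rewrite /word_val big_nil !rcoset1 => /val_inj ->.
rewrite word_val_cons !rcosetM.
pose C : vertex (subgroup_graph iota K) :=
  SigSub (rcosets_mulr A (letter_val iota l)).
by move=> /(IHw C) ->; rewrite (f_letter A C l).
Qed.

(** That g normalizes H is read off stabilizers under right multiplication:
    h fixes the vertex H iff h is in H, and fixes H g iff g h g^-1 is in H.  A
    morphism transports fixed points forward, and the inverse isomorphism
    transports them back. *)
Lemma based_isomorphic_normalizer (H : groupClosed G) (g : G)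
    (v : vertex (subgroup_graph iota [set` H])) :
  val v = rcoset [set` H] g ->
  based_isomorphic (base_vertex iota [set` H]) v <-> normalizer [set` H] g.
Proof.
move=> eqv; split=> [[f [[f' [[fK _] _]] fv]]|nHg]; last first.
  exists (ltranslation nHg); split; first exact: ltranslation_isomorphism.
  by apply: val_inj; rewrite /= eqv lcoset_normalizer.
have f'v : vmap f' v = base_vertex iota [set` H] by rewrite -fv fK.
have fix_base h :
    [set` H] = rcoset [set` H] h <-> h \in H.
  rewrite -[in X in X = _](rcoset1 [set` H]) rcoset_eqP mul1g.
  by rewrite gpredV.
have fix_v h : val v = rcoset (val v) h <-> g * h * g^-1 \in H.
  by rewrite eqv -rcosetM rcoset_eqP invgM mulgA -gpredV !invgM !invgK !mulgA.
apply/normalizerP => h; split=> [/fix_v|/fix_base] fixh.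
  by have := vmap_rcoset f' fixh; rewrite f'v => /fix_base.
apply/fix_v; rewrite -fv.
pose b := base_vertex iota [set` H].
exact: (@vmap_rcoset _ _ f b b h fixh).
Qed.

End SchreierGraph.

Theorem theorem4p15
  (X : finType) (R : set (word X)) (G : groupType) (iota : X -> G)
  (presG : is_presentation R iota)
  (H : groupClosed G) (finH : finite_index [set` H])
  (p : vertex (subgroup_graph iota [set` H]) ->
       seq (edge (hat (subgroup_graph iota [set` H]))))
  (path_p : forall v, is_path (base_vertex iota [set` H]) (p v) v)
  (reduced_p : forall v, reduced (p v)) :
  let g v := word_val iota (path_label (p v)) in
  let V := [set v | based_isomorphic (base_vertex iota [set` H]) v] in
  (forall v, normalizer [set` H] (g v) <->
             based_isomorphic (base_vertex iota [set` H]) v) /\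
  normalizer [set` H] = \bigcup_(v in V) rcoset [set` H] (g v).
Proof.
move=> g V; have [iota_gen _] := presG.
have val_g v : val v = rcoset [set` H] (g v) by exact: is_path_rcoset (path_p v).
have isoP := based_isomorphic_normalizer iota_gen.
split=> [v|]; first by split=> /(isoP H _ _ (val_g v)).
apply/seteqP; split=> [n nHn|n [v /= isov]].
  pose v : vertex (subgroup_graph iota [set` H]) :=
    SigSub (rcosets_mulr (base_vertex iota [set` H]) n).
  exists v; first by apply/(isoP H n v).
  by rewrite -val_g; exact: rcoset_self.
move=> /rcosetP/rcoset_eqP eqn.
by apply/(isoP H n v) => //; rewrite eqn.
Qed.
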